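(* Let $(\mathcal{D},\mathcal{L},\mathcal{R})$ be a geometric pH system with state space $\mathbb{K}^n$, external dimension $m$ and resistive dimension $r$, and set $p=\dim\ker\mathcal{D}+\dim\ker\mathcal{R}+\dim\ker\mathcal{L}$. Then there exists a pH descriptor system of the form $$\begin{bmatrix}\tfrac{\mathrm d}{\mathrm dt}Ez(t)\\ y(t)\end{bmatrix}=\begin{bmatrix}J-R & B\\ B^* & N\end{bmatrix}\begin{bmatrix}z(t)\\ u(t)\end{bmatrix}\qquad (\ast)$$ (that is, a pH descriptor system with $Q=I$, $P=0$, $S=0$) with state $z(t)\in\mathbb{K}^{n+r+p}$, such that the following hold, where $e_L(t)\in\mathbb{K}^n$ denotes the vector of the first $n$ components of $z(t)$: (i) If $(u,x,y)$ is a solution of $(\mathcal{D},\mathcal{L},\mathcal{R})$, then there exists $z$ such that $(u,z,y)$ is a solution of $(\ast)$. (ii) If $(u,z,y)$ is a solution of $(\ast)$, then for every $x_0\in\mathbb{K}^n$ with $(x_0,e_L(0))\in\mathcal{L}$ there exists $x$ such that $(u,x,y)$ is a solution of $(\mathcal{D},\mathcal{L},\mathcal{R})$ with $x(0)=x_0$. Furthermore, if $-\mathcal{L}$ is resistive, then $E=E^*\ge 0$ holds.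
   Context: $\mathbb{K}$ denotes either $\mathbb{R}$ or $\mathbb{C}$, consistently throughout. $A^*$ is the conjugate transpose, $\langle x,y\rangle=y^*x$ is the Euclidean inner product on $\mathbb{K}^n$, and $\ge 0$ for Hermitian matrices means positive semidefinite. For a linear subspace $\mathcal{A}\subset\mathbb{K}^n\times\mathbb{K}^n$ define $\ker\mathcal{A}=\{f:(f,0)\in\mathcal{A}\}$, the adjoint $\mathcal{A}^*=\{(e',f'):\langle f',e\rangle=\langle e',f\rangle\ \forall (e,f)\in\mathcal{A}\}$, and $\alpha\mathcal{A}=\{(e,\alpha f):(e,f)\in\mathcal{A}\}$ for $\alpha\in\mathbb{K}$ (in particular $-\mathcal{A}=\{(e,-f):(e,f)\in\mathcal{A}\}$). A subspace $\mathcal{L}$ of $\mathbb{K}^n\times\mathbb{K}^n$ is a Lagrange structure if $\mathcal{L}=\mathcal{L}^*$. A subspace $\mathcal{D}$ is a Dirac structure if $\mathcal{D}=-\mathcal{D}^*$. A subspace $\mathcal{R}$ is a resistive structure (is resistive) if $\mathcal{R}\subset\mathcal{R}^*$ and $\langle e,f\rangle\le 0$ for all $(e,f)\in\mathcal{R}$; it is a maximal resistive structure if in addition $\dim\mathcal{R}=n$. A geometric pH system with state space $\mathbb{K}^n$, external dimension $m$ and resistive dimension $r$ is a triple $(\mathcal{D},\mathcal{L},\mathcal{R})$ consisting of a Dirac structure $\mathcal{D}\subseteq\mathbb{K}^{n+r+m}\times\mathbb{K}^{n+r+m}$, a Lagrange structure $\mathcal{L}\subset\mathbb{K}^n\times\mathbb{K}^n$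 and a maximal resistive structure $\mathcal{R}\subset\mathbb{K}^r\times\mathbb{K}^r$. A solution of $(\mathcal{D},\mathcal{L},\mathcal{R})$ is a triple $(u,x,y)\in C([0,\infty);\mathbb{K}^m)\times C^1([0,\infty);\mathbb{K}^n)\times C([0,\infty);\mathbb{K}^m)$ for which there exist continuous functions $f_R,e_R:[0,\infty)\to\mathbb{K}^r$ and $e_L:[0,\infty)\to\mathbb{K}^n$ such that for all $t\ge0$ $$(-\dot x(t),f_R(t),y(t),e_L(t),e_R(t),u(t))\in\mathcal{D},\quad (x(t),e_L(t))\in\mathcal{L},\quad (f_R(t),e_R(t))\in\mathcal{R},$$ where the first three entries form the first component in $\mathbb{K}^{n+r+m}$ and the last three form the second component. A pH descriptor system with state dimension $\nu$ and external dimension $m$ is a system $$\begin{bmatrix}\tfrac{\mathrm d}{\mathrm dt}Ez(t)\\ y(t)\end{bmatrix}=\begin{bmatrix}J-R&B-P\\ (B+P)^*&S+N\end{bmatrix}\begin{bmatrix}Qz(t)\\ u(t)\end{bmatrix}$$ with $\mathbb{K}^m$-valued input $u$ and output $y$, $\mathbb{K}^\nu$-valued state $z$, and matrices $E,J,R,Q\in\mathbb{K}^{\nu\times\nu}$, $B,P\in\mathbb{K}^{\nu\times m}$, $S,N\in\mathbb{K}^{m\times m}$ satisfying $E^*Q=Q^*E$, $J=-J^*$, $N=-N^*$, $R=R^*$, $S=S^*$ and $$\begin{bmatrix}Q^*&0\\ 0&I\end{bmatrix}\begin{bmatrix}R&P\\ P^*&S\end{bmatrix}\begin{bmatrix}Q&0\\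 0&I\end{bmatrix}\ge0.$$ A solution of it is a triple $(u,z,y)\in C([0,\infty);\mathbb{K}^{\nu+2m})$ with $Ez\in C^1([0,\infty);\mathbb{K}^\nu)$ such that the system equation is satisfied for all $t\ge 0$. *)

(* Defs.v *)
From HB Require Import structures.
From mathcomp Require Import all_boot all_order all_algebra.
From mathcomp Require Import complex.
From mathcomp Require Import all_classical all_reals all_analysis.

Set Implicit Arguments.
Unset Strict Implicit.
Unset Printing Implicit Defensive.

Import Order.TTheory GRing.Theory Num.Theory.
Import numFieldNormedType.Exports.

Local Open Scope classical_set_scope.
Local Open Scope ring_scope.

Inductive scalars := RealScalars | ComplexScalars.

(* The field K.  Seen as a [numFieldType], it carries the order (on the complex
   numbers, [x <= y] iff [y - x] is real and nonnegative) and the usual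
   topology, from which [matrix] gets the product topology. *)
Definition scalarField (R : realType) (k : scalars) : numFieldType :=
  match k with
  | RealScalars => R
  | ComplexScalars => R[i]%C
  end.

Definition conjK (R : realType) (k : scalars) :
    {rmorphism scalarField R k -> scalarField R k} :=
  match k with
  | RealScalars => (idfun : {rmorphism R -> R})
  | ComplexScalars => (@conjc R : {rmorphism R[i]%C -> R[i]%C})
  end.
Arguments conjK {R k}.

Definition ofReal (R : realType) (k : scalars) : R -> scalarField R k :=
  match k with
  | RealScalars => (fun x : R => x)
  | ComplexScalars => (fun x : R => x%:C%C)
  end.
Arguments ofReal {R} k.

Section Definitions.
Variables (R : realType) (k : scalars).
Local Notation K := (scalarField R k).

Definition ctrmx p q (A : 'M[K]_(p, q)) : 'M[K]_(q, p) := map_mx conjK A^T.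

Definition inner n (x y : 'cV[K]_n) : K := (ctrmx y *m x) ord0 ord0.

Definition psdmx n (A : 'M[K]_n) : Prop :=
  A = ctrmx A /\ forall x : 'cV[K]_n, 0 <= inner (A *m x) x.

Definition inl0 n (f : 'cV[K]_n) : 'cV[K]_n * 'cV[K]_n := (f, 0).

Lemma inl0_is_linear n : linear (@inl0 n).
Proof. by move=> a x y; congr pair => /=; rewrite scaler0 addr0. Qed.

HB.instance Definition _ n :=
  GRing.isLinear.Build K 'cV[K]_n ('cV[K]_n * 'cV[K]_n)%type *:%R (@inl0 n)
    (@inl0_is_linear n).

Definition relker n (A : {vspace 'cV[K]_n * 'cV[K]_n}) : {vspace 'cV[K]_n} :=
  (linfun (@inl0 n) @^-1: A)%VS.

Lemma mem_relker n (A : {vspace 'cV[K]_n * 'cV[K]_n}) (f : 'cV[K]_n) :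
  (f \in relker A) = ((f, 0) \in A).
Proof. by rewrite /relker -memv_preim lfunE. Qed.

Definition reladj n (A : set ('cV[K]_n * 'cV[K]_n)) : set ('cV[K]_n * 'cV[K]_n) :=
  [set w | forall v, A v -> inner w.2 v.1 = inner w.1 v.2].

Definition relscale n (a : K) (A : set ('cV[K]_n * 'cV[K]_n)) :
    set ('cV[K]_n * 'cV[K]_n) :=
  [set (v.1, a *: v.2) | v in A].

Definition lagrange n (L : {vspace 'cV[K]_n * 'cV[K]_n}) : Prop :=
  [set` L] = reladj [set` L].

Definition dirac n (D : {vspace 'cV[K]_n * 'cV[K]_n}) : Prop :=
  [set` D] = relscale (-1) (reladj [set` D]).

Definition resistive n (A : set ('cV[K]_n * 'cV[K]_n)) : Prop :=
  A `<=` reladj A /\ forall v, A v -> inner v.1 v.2 <= 0.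

Definition max_resistive n (Rs : {vspace 'cV[K]_n * 'cV[K]_n}) : Prop :=
  resistive [set` Rs] /\ \dim Rs = n.

(* Functions on the half-line are encoded as functions on [R]; only their
   values at nonnegative times are ever constrained. *)
Definition continuous_halfline n (x : R -> 'cV[K]_n) : Prop :=
  {within `[0, +oo[, continuous x}.

(* The difference quotient is restricted to [0 <= t + h], hence one-sided at
   [t = 0]. *)
Definition derivative_halfline n (x dx : R -> 'cV[K]_n) : Prop :=
  forall t : R, 0 <= t ->
    (ofReal k h)^-1 *: (x (t + h) - x t)
      @[h --> within [set h : R | 0 <= t + h] 0^'] --> dx t.

Definition C1_halfline n (x dx : R -> 'cV[K]_n) : Prop :=
  derivative_halfline x dx /\ continuous_halfline dx.

Definition geometric_pH n m r
    (D : {vspace 'cV[K]_(n + r + m) * 'cV[K]_(n + r + m)})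
    (L : {vspace 'cV[K]_n * 'cV[K]_n})
    (Rs : {vspace 'cV[K]_r * 'cV[K]_r}) : Prop :=
  [/\ dirac D, lagrange L & max_resistive Rs].

Definition geometric_pH_solution n m r
    (D : {vspace 'cV[K]_(n + r + m) * 'cV[K]_(n + r + m)})
    (L : {vspace 'cV[K]_n * 'cV[K]_n})
    (Rs : {vspace 'cV[K]_r * 'cV[K]_r})
    (u : R -> 'cV[K]_m) (x : R -> 'cV[K]_n) (y : R -> 'cV[K]_m) : Prop :=
  [/\ continuous_halfline u, continuous_halfline y &
  exists dx : R -> 'cV[K]_n, C1_halfline x dx /\
  exists (fR eR : R -> 'cV[K]_r) (eL : R -> 'cV[K]_n),
    [/\ continuous_halfline fR, continuous_halfline eR, continuous_halfline eL &
    forall t : R, 0 <= t ->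
      [/\ (col_mx (col_mx (- dx t) (fR t)) (y t),
           col_mx (col_mx (eL t) (eR t)) (u t)) \in D,
          (x t, eL t) \in L & (fR t, eR t) \in Rs]]].

Definition pH_descriptor nu m (E J Rm Q : 'M[K]_nu) (B P : 'M[K]_(nu, m))
    (S N : 'M[K]_m) : Prop :=
  [/\ ctrmx E *m Q = ctrmx Q *m E,
      J = - ctrmx J, N = - ctrmx N, Rm = ctrmx Rm & S = ctrmx S] /\
  psdmx (block_mx (ctrmx Q) 0 0 1%:M *m block_mx Rm P (ctrmx P) S
         *m block_mx Q 0 0 1%:M).

Definition pH_descriptor_solution nu m (E J Rm Q : 'M[K]_nu)
    (B P : 'M[K]_(nu, m)) (S N : 'M[K]_m)
    (u : R -> 'cV[K]_m) (z : R -> 'cV[K]_nu) (y : R -> 'cV[K]_m) : Prop :=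
  [/\ continuous_halfline u, continuous_halfline z, continuous_halfline y &
  exists dEz : R -> 'cV[K]_nu, C1_halfline (fun t => E *m z t) dEz /\
    forall t : R, 0 <= t ->
      col_mx (dEz t) (y t) =
      block_mx (J - Rm) (B - P) (ctrmx (B + P)) (S + N)
        *m col_mx (Q *m z t) (u t)].

End Definitions.

(* Main.v *)
(* A relation A in K^n x K^n of dimension n which is isotropic for
   <f',e> - eps <e',f>, eps = 1 or -1, has the form
     A = { (A0 e + V c, e) | V^* e = 0 },
   where A0 = eps A0^*, the columns of V form a basis of ker A, and A0 maps
   into the orthogonal complement of ker A.  With (J0, V), (L0, VL), (R0, VR)
   representing D, L, R in this way, the state of the descriptor system is
   z = (e_L, e_R, c_D, -c_R, mu): the constraints V^* e = 0 become algebraic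
   equations with the parameters c as multipliers, and
   x = L0 e_L + VL c_L enters only through
   x' = (L0 e_L)' + VL mu, mu = c_L', so that E = diag(L0, 0, 0).  Since L0 e_L
   is the orthogonal projection of x, it is C^1 whenever x is; conversely, x is
   recovered from z by integrating mu, with the initial value of c_L prescribed
   by x_0. *)
Require Import Defs.
From HB Require Import structures.
From mathcomp Require Import all_boot all_order all_algebra.
From mathcomp Require Import complex ring.
From mathcomp Require Import all_classical all_reals all_analysis.

Set Implicit Arguments.
Unset Strict Implicit.
Unset Printing Implicit Defensive.

Import Order.TTheory GRing.Theory Num.Theory.
Import numFieldNormedType.Exports.

Local Open Scope classical_set_scope.
Local Open Scope ring_scope.

(** * Limits and derivatives on the half-line *)

(** A neighbourhood of a matrix contains a box of entrywise neighbourhoods. There are finitely many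
    entries, so the filter is closed under the resulting intersection. *)
Lemma cvg_coord (T : Type) (F : set_system T) (FF : Filter F) (K : numFieldType)
    p q (f : T -> 'M[K]_(p, q)) (l : 'M[K]_(p, q)) :
  (forall i j, f x i j @[x --> F] --> l i j) -> f x @[x --> F] --> l.
Proof.
move=> fl A [P nP PA]; apply: filterS PA _.
have : \forall x \near F, forall ij, P ij.1 ij.2 (f x ij.1 ij.2).
  by apply: filter_forall => -[i j] /=; exact: fl.
by apply: filterS => x Px i j; exact: (Px (i, j)).
Qed.

Lemma cvg_entry (T : Type) (F : set_system T) (FF : Filter F) (K : numFieldType)
    p q (f : T -> 'M[K]_(p, q)) (l : 'M[K]_(p, q)) i j :
  f x @[x --> F] --> l -> f x i j @[x --> F] --> l i j.
Proof.
move=> fl; apply: (@cvg_comp _ _ _ f (fun M : 'M[K]_(p, q) => M i j)) fl _.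
exact: coord_continuous.
Qed.

Lemma cvg_mulmxl (T : Type) (F : set_system T) (FF : Filter F) (K : numFieldType)
    p q s (A : 'M[K]_(p, q)) (f : T -> 'M[K]_(q, s)) (l : 'M[K]_(q, s)) :
  f x @[x --> F] --> l -> A *m f x @[x --> F] --> A *m l.
Proof.
move=> fl; apply: cvg_coord => i j; rewrite mxE.
under eq_fun do rewrite mxE.
apply: cvg_big => [x|o _]; first exact: (@add_continuous K^o x).
by apply: cvgM; [exact: cvg_cst|exact: cvg_entry].
Qed.

(** * Continuity of the real and imaginary parts *)

Section Complex.
Variable R : realType.
Local Notation C := (scalarField R ComplexScalars).

Lemma ofReal_complex_continuous : continuous (@ofReal R ComplexScalars).
Proof.
move=> x; apply/cvgrPdist_lt => e.
(* A positive complex number is real, so the bound [e] can be replaced by its real part. *)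
rewrite (@ltcE R) /= => /andP[/eqP e0 Re0].
have /cvgrPdist_lt : id y @[y --> x] --> x by exact: cvg_id.
move=> /(_ _ Re0); apply: filterS => y /= xy.
rewrite -rmorphB /= (@normc_def R) /= expr0n /= addr0 sqrtr_sqr.
by rewrite (@ltcE R) /= xy e0 eqxx.
Qed.

Lemma Re_continuous : continuous (@complex.Re R : C -> R).
Proof.
move=> x; have Fx : Filter (nbhs (x : C)) by exact: (@nbhs_filter C).
apply/cvgrPdist_lt => e e0.
have /cvgrPdist_lt : id y @[y --> (x : C)] --> (x : C) by exact: cvg_id.
have e0' : 0 < ofReal ComplexScalars e by rewrite (@ltcE R) /= eqxx.
move=> /(_ _ e0'); apply: filterS => y /= xy.
rewrite -ltcR; apply: le_lt_trans xy.
have := normc_ge_Re ((x : R[i]%C) - y).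
by case: (x) (y) => [a b] [c d].
Qed.

Lemma Im_continuous : continuous (@complex.Im R : C -> R).
Proof.
have -> : @complex.Im R = (fun x : C => complex.Re (- ('i%C : C) * x)).
  apply/funext => -[a b] /=.
  by rewrite !(mulNr, mul0r, oppr0, mul1r, sub0r, opprK).
move=> x; have Fx : Filter (nbhs (x : C)) by exact: (@nbhs_filter C).
apply: (@cvg_comp _ _ _ (fun x : C => - ('i%C : C) * x)); last first.
  exact: Re_continuous.
by apply: cvgM; [exact: cvg_cst|exact: cvg_id].
Qed.

Lemma cvg_complex (T : Type) (F : set_system T) (FF : Filter F)
    (f g : T -> R) (a b : R) :
  f x @[x --> F] --> a -> g x @[x --> F] --> b ->
  ((f x +i* g x)%C : C) @[x --> F] --> ((a +i* b)%C : C).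
Proof.
move=> fa gb.
have E (u v : R) : (u +i* v)%C =
    ofReal ComplexScalars u + ('i%C : C) * ofReal ComplexScalars v.
  exact: complexE.
rewrite E; under eq_fun do rewrite E.
apply: cvgD.
  by apply: cvg_comp fa _; exact: ofReal_complex_continuous.
apply: cvgM; first exact: cvg_cst.
by apply: cvg_comp gb _; exact: ofReal_complex_continuous.
Qed.

End Complex.

(** * Primitives of continuous scalar functions *)

Section Antiderivative.
Variable R : realType.

Lemma derivable_cvg_derive1 (F : R -> R) t : derivable F t 1 ->
  h^-1 * (F (t + h) - F t) @[h --> 0^'] --> F^`()%classic t.
Proof.
move=> dF; rewrite derive1E.
have {}dF : h^-1 *: ((F \o shift t) (h *: 1) - F t) @[h --> 0^'] --> 'D_1 F t.
  exact: dF.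
apply: cvg_trans dF; apply: near_eq_cvg; apply: nearW => h /=.
by rewrite [h *: 1]mulr1 (addrC t).
Qed.

Lemma antiderivative_real (f : R -> R) : continuous f ->
  exists F : R -> R, forall t, 0 <= t ->
    h^-1 * (F (t + h) - F t) @[h --> 0^'] --> f t.
Proof.
move=> fc.
(* Starting the integral at -1 makes every [t >= 0], including 0, an interior point, so the
   two-sided derivative exists there. *)
exists (fun x => \int[lebesgue_measure]_(s in [set` `[-1, x]]) f s) => t t0.
have t1 : t < t + 1 by rewrite ltrDl.
have fi : lebesgue_measure.-integrable `[-1, t + 1] (EFin \o f).
  apply: continuous_compact_integrable; first exact: segment_compact.
  by apply: continuous_subspaceT => x; exact: fc.
have Nt : (BLeft (-1 : R)%R < BRight t)%E.
  by rewrite lte_fin (lt_le_trans _ t0)// ltrN10.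
have [dF <-] := continuous_FTC1 t1 fi Nt (fc t).
exact: derivable_cvg_derive1.
Qed.

(** Even reflection extends a function from the half-line to the whole line without changing it at
    nonnegative times. This makes [antiderivative_real] applicable to half-line data. *)
Lemma continuous_norm_arg (f : R -> R) :
  (forall t : R, 0 <= t -> f s @[s --> within `[0, +oo[ (nbhs t)] --> f t) ->
  continuous (fun s : R => f `|s|).
Proof.
move=> fc t; apply: (@cvg_comp _ _ _ Num.norm f); last exact: fc (normr_ge0 t).
move=> A nA.
have : nbhs t (fun s : R => `[0, +oo[%classic `|s| -> A `|s|).
  exact: (@norm_continuous R R t _ nA).
by apply: filterS => s; apply; rewrite /= in_itv /= normr_ge0.
Qed.

Lemma antiderivative_scalar k (f : R -> scalarField R k) :
  (forall t : R, 0 <= t -> f s @[s --> within `[0, +oo[ (nbhs t)] --> f t) ->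
  exists F : R -> scalarField R k, forall t : R, 0 <= t ->
    (ofReal k h)^-1 * (F (t + h) - F t)
      @[h --> within [set h : R | 0 <= t + h] 0^'] --> f t.
Proof.
case: k f => f fc.
  have [F dF] := antiderivative_real (continuous_norm_arg fc).
  exists F => t t0; apply: cvg_within_filter.
  by have := dF _ t0; rewrite ger0_norm.
(* Over the complex numbers the real and imaginary parts are integrated separately. *)
have Refc (t : R) : 0 <= t ->
    complex.Re (f s) @[s --> within `[0, +oo[ (nbhs t)] --> complex.Re (f t).
  by move=> t0; apply: cvg_comp (fc t t0) _; exact: Re_continuous.
have Imfc (t : R) : 0 <= t ->
    complex.Im (f s) @[s --> within `[0, +oo[ (nbhs t)] --> complex.Im (f t).
  by move=> t0; apply: cvg_comp (fc t t0) _; exact: Im_continuous.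
have [F dF] := antiderivative_real (continuous_norm_arg Refc).
have [G dG] := antiderivative_real (continuous_norm_arg Imfc).
exists (fun t => (F t +i* G t)%C) => t t0; apply: cvg_within_filter.
have -> : f t = (complex.Re (f t) +i* complex.Im (f t))%C by case: (f t).
have {}dF := dF _ t0; have {}dG := dG _ t0.
rewrite ger0_norm // in dF; rewrite ger0_norm // in dG.
apply: cvg_trans (cvg_complex _ dF dG); apply: near_eq_cvg; apply: nearW => h.
have quotE (c a b a' b' : R) : (c * (a - b) +i* (c * (a' - b')))%C =
    c%:C%C * ((a +i* a')%C - (b +i* b')%C) :> R[i]%C by simpc.
by rewrite -[(ofReal _ _)^-1]fmorphV -quotE.
Qed.

End Antiderivative.

(** * Calculus of vector-valued functions on the half-line *)

Section HalfLine.
Variables (R : realType) (k : scalars).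
Local Notation K := (scalarField R k).

Lemma continuous_halflineP n (x : R -> 'cV[K]_n) :
  continuous_halfline x <->
  forall t : R, 0 <= t -> x s @[s --> within `[0, +oo[ (nbhs t)] --> x t.
Proof.
rewrite /continuous_halfline; split=> [/subspace_continuousP xc t t0|xc].
  by apply: xc; rewrite /= in_itv /= t0.
apply/subspace_continuousP => t; rewrite /= in_itv /= andbT; exact: xc.
Qed.

Lemma eq_continuous_halfline n (x y : R -> 'cV[K]_n) :
  (forall t, 0 <= t -> x t = y t) ->
  continuous_halfline x -> continuous_halfline y.
Proof.
move=> xy /continuous_halflineP xc; apply/continuous_halflineP => t t0.
rewrite -xy //; apply: cvg_trans (xc t t0); apply: near_eq_cvg.
rewrite near_withinE; apply: nearW => s /=.
by rewrite in_itv /= andbT; exact: xy.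
Qed.

Lemma continuous_halflineD n (x y : R -> 'cV[K]_n) :
  continuous_halfline x -> continuous_halfline y ->
  continuous_halfline (fun t => x t + y t).
Proof.
move=> /continuous_halflineP xc /continuous_halflineP yc.
by apply/continuous_halflineP => t t0; apply: cvgD; [exact: xc|exact: yc].
Qed.

Lemma continuous_halfline_mulmx n p (A : 'M[K]_(p, n)) (x : R -> 'cV[K]_n) :
  continuous_halfline x -> continuous_halfline (fun t => A *m x t).
Proof.
move=> /continuous_halflineP xc; apply/continuous_halflineP => t t0.
by apply: cvg_mulmxl; exact: xc.
Qed.

Lemma eq_derivative_halfline n (x y dx : R -> 'cV[K]_n) :
  (forall t, 0 <= t -> x t = y t) ->
  derivative_halfline x dx -> derivative_halfline y dx.
Proof.
move=> xy xd t t0.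
apply: cvg_trans (xd t t0); apply: near_eq_cvg.
by rewrite near_withinE; apply: nearW => h /= th; rewrite !xy.
Qed.

Lemma derivative_halflineD n (x y dx dy : R -> 'cV[K]_n) :
  derivative_halfline x dx -> derivative_halfline y dy ->
  derivative_halfline (fun t => x t + y t) (fun t => dx t + dy t).
Proof.
move=> xd yd t t0; under eq_fun do rewrite opprD addrACA scalerDr.
by apply: cvgD; [exact: xd|exact: yd].
Qed.

Lemma derivative_halfline_mulmx n p (A : 'M[K]_(p, n)) (x dx : R -> 'cV[K]_n) :
  derivative_halfline x dx ->
  derivative_halfline (fun t => A *m x t) (fun t => A *m dx t).
Proof.
move=> xd t t0; under eq_fun do rewrite -mulmxBr scalemxAr.
by apply: cvg_mulmxl; exact: xd.
Qed.

(** Every [h > 0] is admissible when [t >= 0], so properness is inherited from the right-hand filter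
    at 0. Uniqueness of derivatives rests on it, also at [t = 0]. *)
Lemma within_dnbhs_proper (t : R) : 0 <= t ->
  ProperFilter (within [set h : R | 0 <= t + h] 0^').
Proof.
move=> t0; split; last exact: within_filter.
move=> F0; apply: (@filter_not_empty _ (0^'+ : set_system R)).
have {}F0 : \forall h \near (0 : R), h != 0 -> 0 <= t + h -> False by exact: F0.
apply: (@filterS _ (nbhs (0 : R)) _ _ _ _ F0) => h hF h0.
apply: hF; first by rewrite gt_eqF.
by rewrite /= addr_ge0 // ltW.
Qed.

Lemma derivative_halfline_unique n (x dx dx' : R -> 'cV[K]_n) :
  derivative_halfline x dx -> derivative_halfline x dx' ->
  forall t, 0 <= t -> dx t = dx' t.
Proof.
move=> xd xd' t t0; have FF := within_dnbhs_proper t0.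
apply/colP => i.
have xi := cvg_entry FF (i := i) (j := ord0) (xd t t0).
have xi' := cvg_entry FF (i := i) (j := ord0) (xd' t t0).
exact: (@cvg_unique K^o (@norm_hausdorff K K^o) _ (fmap_proper_filter _ FF)
  _ _ xi xi').
Qed.

Lemma antiderivative_halfline n (dx : R -> 'cV[K]_n) (x0 : 'cV[K]_n) :
  continuous_halfline dx ->
  exists x, C1_halfline x dx /\ x 0 = x0.
Proof.
move=> dxc.
have /choice[F dF] (i : 'I_n) : exists F : R -> K, forall t, 0 <= t ->
    (ofReal k h)^-1 * (F (t + h) - F t)
      @[h --> within [set h : R | 0 <= t + h] 0^'] --> dx t i ord0.
  apply: antiderivative_scalar => t t0; apply: cvg_entry.
  by move/continuous_halflineP : dxc; exact.
(* The primitives have uncontrolled values at 0; the shift prescribes [x0] without affecting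
   difference quotients. *)
exists (fun t => \col_i (F i t - F i 0) + x0); split; last first.
  by apply/colP => i; rewrite !mxE subrr add0r.
split=> // t t0; apply: cvg_coord => i j; rewrite ord1.
apply: cvg_trans (dF i t t0); apply: near_eq_cvg; apply: nearW => h.
by rewrite !mxE opprD addrACA subrr addr0 opprB addrA subrK.
Qed.

End HalfLine.

(** * Linear relations *)

Section Hermitian.
Variables (R : realType) (k : scalars).
Local Notation K := (scalarField R k).

Lemma conjKK : involutive (@conjK R k).
Proof. by case: k => // -[a b]; rewrite /= opprK. Qed.

Lemma mulK_conj_ge0 (x : K) : 0 <= conjK x * x.
Proof.
by case: k x => /= x; [rewrite -expr2 sqr_ge0 | rewrite mulrC mulcJ_ge0].
Qed.

Lemma conjK_eq0 (x : K) : (conjK x == 0) = (x == 0).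
Proof. exact: fmorph_eq0. Qed.

Lemma ctrmxE p q (A : 'M[K]_(p, q)) i j : ctrmx A i j = conjK (A j i).
Proof. by rewrite !mxE. Qed.

Lemma ctrmxK p q (A : 'M[K]_(p, q)) : ctrmx (ctrmx A) = A.
Proof. by apply/matrixP => i j; rewrite !ctrmxE conjKK. Qed.

Lemma ctrmx_mul p q s (A : 'M[K]_(p, q)) (B : 'M[K]_(q, s)) :
  ctrmx (A *m B) = ctrmx B *m ctrmx A.
Proof. by rewrite /ctrmx trmx_mul map_mxM. Qed.

Lemma ctrmxD p q (A B : 'M[K]_(p, q)) : ctrmx (A + B) = ctrmx A + ctrmx B.
Proof. by rewrite /ctrmx linearD /= map_mxD. Qed.

Lemma ctrmxN p q (A : 'M[K]_(p, q)) : ctrmx (- A) = - ctrmx A.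
Proof. by rewrite /ctrmx linearN /= map_mxN. Qed.

Lemma ctrmx0 p q : ctrmx (0 : 'M[K]_(p, q)) = 0.
Proof. by rewrite /ctrmx linear0 map_mx0. Qed.

Lemma ctrmx1 p : ctrmx (1%:M : 'M[K]_p) = 1%:M.
Proof. by rewrite /ctrmx trmx1 map_mx1. Qed.

Lemma ctrmx_block p1 p2 q1 q2 (A : 'M[K]_(p1, q1)) (B : 'M[K]_(p1, q2))
    (C : 'M[K]_(p2, q1)) (D : 'M[K]_(p2, q2)) :
  ctrmx (block_mx A B C D) = block_mx (ctrmx A) (ctrmx C) (ctrmx B) (ctrmx D).
Proof. by rewrite /ctrmx tr_block_mx map_block_mx. Qed.

Lemma ctrmx_col p1 p2 q (A : 'M[K]_(p1, q)) (B : 'M[K]_(p2, q)) :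
  ctrmx (col_mx A B) = row_mx (ctrmx A) (ctrmx B).
Proof. by rewrite /ctrmx tr_col_mx map_row_mx. Qed.

Lemma ctrmx_row p q1 q2 (A : 'M[K]_(p, q1)) (B : 'M[K]_(p, q2)) :
  ctrmx (row_mx A B) = col_mx (ctrmx A) (ctrmx B).
Proof. by rewrite /ctrmx tr_row_mx map_col_mx. Qed.

Lemma ctrmx_inv p (A : 'M[K]_p) : ctrmx (invmx A) = invmx (ctrmx A).
Proof. by rewrite /ctrmx trmx_inv map_invmx. Qed.

Lemma innerE n (x y : 'cV[K]_n) : inner x y = \sum_i conjK (y i ord0) * x i ord0.
Proof. by rewrite /inner mxE; apply: eq_bigr => i _; rewrite ctrmxE. Qed.

Lemma inner_conj n (x y : 'cV[K]_n) : inner x y = conjK (inner y x).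
Proof.
rewrite !innerE rmorph_sum; apply: eq_bigr => i _.
by rewrite rmorphM conjKK mulrC.
Qed.

Lemma inner0l n (y : 'cV[K]_n) : inner 0 y = 0.
Proof. by rewrite /inner mulmx0 mxE. Qed.

Lemma inner0r n (y : 'cV[K]_n) : inner y 0 = 0.
Proof. by rewrite /inner ctrmx0 mul0mx mxE. Qed.

Lemma innerDl n (x y z : 'cV[K]_n) : inner (x + y) z = inner x z + inner y z.
Proof. by rewrite /inner mulmxDr mxE. Qed.

Lemma innerDr n (x y z : 'cV[K]_n) : inner x (y + z) = inner x y + inner x z.
Proof. by rewrite /inner ctrmxD mulmxDl mxE. Qed.

Lemma innerZl n a (x y : 'cV[K]_n) : inner (a *: x) y = a * inner x y.
Proof. by rewrite /inner -scalemxAr mxE. Qed.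

Lemma innerNl n (x y : 'cV[K]_n) : inner (- x) y = - inner x y.
Proof. by rewrite /inner mulmxN mxE. Qed.

Lemma innerNr n (x y : 'cV[K]_n) : inner x (- y) = - inner x y.
Proof. by rewrite /inner ctrmxN mulNmx mxE. Qed.

Lemma inner_mulmxl n p (A : 'M[K]_(n, p)) x y :
  inner (A *m x) y = inner x (ctrmx A *m y).
Proof. by rewrite /inner ctrmx_mul ctrmxK mulmxA. Qed.

Lemma inner_col n p (x y : 'cV[K]_n) (x' y' : 'cV[K]_p) :
  inner (col_mx x x') (col_mx y y') = inner x y + inner x' y'.
Proof. by rewrite /inner ctrmx_col mul_row_col mxE. Qed.

Lemma inner_eq0 n (x : 'cV[K]_n) : inner x x = 0 -> x = 0.
Proof.
move=> /eqP; rewrite innerE psumr_eq0; last by move=> i _; exact: mulK_conj_ge0.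
move=> /allP x0; apply/colP => i; apply/eqP; rewrite mxE.
have := x0 i (mem_index_enum _).
by rewrite mulf_eq0 conjK_eq0 orbb.
Qed.

Lemma inner_mulmx_inj n p (A B : 'M[K]_(n, p)) :
  (forall x y, inner (A *m x) y = inner (B *m x) y) -> A = B.
Proof.
move=> AB; apply/subr0_eq; apply/matrixP => i j.
suff : (A - B) *m delta_mx j ord0 = 0 :> 'cV_n.
  by rewrite -colE => /colP/(_ i); rewrite !mxE.
by apply: inner_eq0; rewrite [in LHS]mulmxBl innerDl innerNl AB subrr.
Qed.

Lemma lfun_mulmx n p (f : 'Hom('cV[K]_n, 'cV[K]_p)) :
  exists G : 'M[K]_(p, n), forall x, f x = G *m x.
Proof.
exists (\matrix_(i, j) f (delta_mx j ord0) i ord0) => x.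
rewrite {1}[x]matrix_sum_delta linear_sum; apply/colP => i.
rewrite summxE mxE; apply: eq_bigr => j _.
by rewrite big_ord1 linearZ /= !mxE mulrC.
Qed.

(** If V^* V x = 0, then <Vx, Vx> = <x, V^* V x> = 0, hence Vx = 0 and x = 0. The transposes appear
    because row freeness concerns multiplication from the left. *)
Lemma gram_unit n d (V : 'M[K]_(n, d)) :
  (forall x : 'cV_d, V *m x = 0 -> x = 0) -> ctrmx V *m V \in unitmx.
Proof.
move=> Vinj; rewrite -unitmx_tr -row_free_unit; apply: inj_row_free => v v0.
apply: trmx_inj; rewrite trmx0; apply: Vinj; apply: inner_eq0.
by rewrite inner_mulmxl mulmxA -(trmxK (_ *m V)) -trmx_mul v0 trmx0 inner0r.
Qed.

(** The columns of [V] are a basis of [W], and [V'] is the pseudo-inverse (V^* V)^-1 V^* of [V].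
    Thus [V *m V'] is the orthogonal projection onto [W], with no orthonormalisation involved. *)
Lemma vspace_basis_mx n (W : {vspace 'cV[K]_n}) :
  exists (V : 'M[K]_(n, \dim W)) (V' : 'M[K]_(\dim W, n)),
    [/\ V' *m V = 1%:M, V *m V' = ctrmx (V *m V') &
      forall x, x \in W <-> exists c, x = V *m c].
Proof.
pose V := \matrix_(i < n, j < \dim W) (vbasis W)`_j i ord0.
have VE (c : 'cV_(\dim W)) : V *m c = \sum_j c j ord0 *: (vbasis W)`_j.
  apply/colP => i; rewrite mxE summxE; apply: eq_bigr => j _.
  by rewrite !mxE mulrC.
have Vinj (c : 'cV_(\dim W)) : V *m c = 0 -> c = 0.
  have /freeP free_W := basis_free (vbasisP W).
  rewrite VE => /free_W c0.
  by apply/colP => j; rewrite c0 mxE.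
have VVu := gram_unit Vinj.
exists V, (invmx (ctrmx V *m V) *m ctrmx V); split.
- by rewrite -mulmxA mulVmx.
- by rewrite !ctrmx_mul ctrmx_inv ctrmxK ctrmx_mul ctrmxK mulmxA.
- move=> x; split=> [xW|[c ->]].
    exists (\col_j coord (vbasis W) j x).
    by rewrite VE [LHS](coord_vbasis xW); apply: eq_bigr => j _; rewrite mxE.
  rewrite VE; apply: memv_suml => j _; apply: memvZ; apply: vbasis_mem.
  by apply: mem_nth; rewrite size_tuple.
Qed.

(** The orthogonal complement is the kernel of V^* for a basis matrix V of [W]. Since V'^* is a
    right inverse of V^*, that map is onto, and rank-nullity gives the dimension. *)
Lemma orth_vspace n (W : {vspace 'cV[K]_n}) :
  exists2 W' : {vspace 'cV[K]_n}, (\dim W' + \dim W)%N = n &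
    forall x, x \in W' <-> forall w, w \in W -> inner x w = 0.
Proof.
have [V [V' [V'V _ memW]]] := vspace_basis_mx W.
pose f : 'Hom('cV[K]_n, 'cV[K]_(\dim W)) := linfun (mulmx (ctrmx V)).
exists (lker f) => [|x].
  have := limg_ker_dim f fullv; rewrite capfv.
  suff -> : limg f = fullv by rewrite !dimvf /= !dim_matrix !mulr1.
  apply/vspaceP => y; rewrite memvf; apply/memv_imgP.
  exists (ctrmx V' *m y); first exact: memvf.
  by rewrite lfunE /= mulmxA -ctrmx_mul V'V ctrmx1 mul1mx.
rewrite memv_ker lfunE /=; split=> [/eqP Vx w /memW[c ->]|xW].
  by rewrite inner_conj inner_mulmxl Vx inner0r rmorph0.
apply/eqP; apply: inner_eq0; rewrite inner_mulmxl ctrmxK.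
by apply: xW; apply/memW; eexists.
Qed.

(** * Kernel, range and matrix form of an isotropic relation *)

Section Relations.
Variables (n : nat) (A : {vspace 'cV[K]_n * 'cV[K]_n}).

Definition relran : {vspace 'cV[K]_n} :=
  (linfun (@snd 'cV[K]_n 'cV[K]_n) @: A)%VS.

Lemma mem_relran e : e \in relran <-> exists f, (f, e) \in A.
Proof.
split=> [/memv_imgP[[f e'] fA ->]|[f fA]].
  by exists f; rewrite lfunE.
by apply/memv_imgP; exists (f, e) => //; rewrite lfunE.
Qed.

(** Rank-nullity for the second projection restricted to [A], whose kernel is the image of
    [relker A] under [inl0]. *)
Lemma dim_rel : \dim A = (\dim (relker A) + \dim relran)%N.
Proof.
rewrite -(limg_ker_dim (linfun (@snd 'cV[K]_n 'cV[K]_n)) A) -/relran.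
congr addn.
rewrite -(@limg_dim_eq _ _ _ (linfun (@inl0 R k n)) (relker A)).
  congr (\dim _); apply/vspaceP => -[f e]; apply/idP/idP.
    rewrite memv_cap memv_ker lfunE /= => /andP[fA /eqP e0].
    apply/memv_imgP; exists f; last by rewrite lfunE e0.
    by rewrite mem_relker -e0.
  move=> /memv_imgP[x]; rewrite mem_relker lfunE => xA [-> ->].
  by rewrite memv_cap xA memv_ker lfunE /=.
apply/eqP; rewrite -subv0; apply/subvP => x; rewrite memv_cap memv_ker lfunE.
by move=> /andP[_ /eqP[->]]; exact: mem0v.
Qed.

Variable eps : K.
Hypothesis eps2 : eps * eps = 1.

(** Testing the membership criterion on pairs (f, 0) shows that the kernel of [A] is exactly the
    orthogonal complement of its range, so the two dimensions add up to [n]. *)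
Lemma dim_maximal_isotropic :
  (forall w, w \in A <->
    forall v, v \in A -> inner w.2 v.1 = eps * inner w.1 v.2) -> \dim A = n.
Proof.
move=> memA; have [N dimN memN] := orth_vspace relran.
rewrite dim_rel -[RHS]dimN; congr (\dim _ + _)%N; apply/vspaceP => f.
have eq0 (a : K) : eps * a = 0 -> a = 0.
  by move=> a0; rewrite -[a]mul1r -eps2 -mulrA a0 mulr0.
rewrite mem_relker; apply/idP/idP => [/memA fA|/memN fN].
  apply/memN => e /mem_relran[g gA]; apply: eq0.
  by rewrite -(fA _ gA) inner0l.
apply/memA => -[g e] gA /=; rewrite inner0l fN ?mulr0 //.
by apply/mem_relran; exists g.
Qed.

Hypothesis isoA : forall v w, v \in A -> w \in A ->
  inner w.2 v.1 = eps * inner w.1 v.2.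
Hypothesis dimA : \dim A = n.

(** Isotropy makes the range orthogonal to the kernel; [dim_rel] and [dimA] turn this inclusion into
    an equality. *)
Lemma relran_orth e :
  e \in relran <-> forall f, f \in relker A -> inner e f = 0.
Proof.
have [N dimN memN] := orth_vspace (relker A).
suff -> : relran = N by exact: memN.
apply/eqP; rewrite eqEdim; apply/andP; split.
  apply/subvP => x /mem_relran[f fA]; apply/memN => g; rewrite mem_relker => gA.
  by have := isoA gA fA; rewrite /= inner0r mulr0.
by rewrite -(leq_add2r (\dim (relker A))) dimN addnC -dim_rel dimA.
Qed.

Lemma relation_representation :
  exists (A0 : 'M[K]_n) (V : 'M[K]_(n, \dim (relker A)))
      (V' : 'M[K]_(\dim (relker A), n)),
    [/\ A0 = eps *: ctrmx A0, V' *m V = 1%:M, V' *m A0 = 0 &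
      forall f e, (f, e) \in A <->
        ctrmx V *m e = 0 /\ exists c, f = A0 *m e + V *m c].
Proof.
have [V [V' [V'V PH memV]]] := vspace_basis_mx (relker A).
have ranP e : e \in relran <-> ctrmx V *m e = 0.
  rewrite relran_orth; split=> [eV|Ve f /memV[c ->]].
    apply: inner_eq0; rewrite inner_mulmxl ctrmxK; apply: eV.
    by apply/memV; eexists.
  by rewrite inner_conj inner_mulmxl Ve inner0r rmorph0.
(* [P] is the orthogonal projection onto the complement of the kernel, which is [relran] by
   [ranP]. *)
pose P := 1%:M - V *m V'.
have PE : ctrmx P = P by rewrite /P ctrmxD ctrmxN ctrmx1 -PH.
have PV : P *m V = 0 by rewrite mulmxBl -mulmxA V'V mul1mx mulmx1 subrr.
have V'P : V' *m P = 0 by rewrite mulmxBr mulmxA V'V mul1mx mulmx1 subrr.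
have Pran e : P *m e \in relran.
  by apply/ranP; rewrite -PE mulmxA -ctrmx_mul PV ctrmx0 mul0mx.
have Pid e : e \in relran -> P *m e = e.
  move=> /ranP Ve; rewrite mulmxBl mul1mx PH ctrmx_mul -mulmxA Ve mulmx0.
  by rewrite subr0.
(* [s] is a linear section over [relran] of the second projection of [A]. *)
pose h : 'Hom(('cV[K]_n * 'cV[K]_n)%type, 'cV[K]_n) :=
  (linfun (@snd 'cV[K]_n 'cV[K]_n) \o projv A)%VF.
pose s : 'Hom('cV[K]_n, ('cV[K]_n * 'cV[K]_n)%type) := (projv A \o h^-1)%VF.
have sA e : s e \in A by rewrite lfunE; exact: memv_proj.
have s2 e : e \in relran -> (s e).2 = e.
  move=> /mem_relran[f fA].
  have he : e \in limg h.
    apply/memv_imgP; exists (f, e); first exact: memvf.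
    by rewrite lfunE /= projv_id // lfunE.
  have := limg_lfunVK he.
  by rewrite !lfunE /= lfunE.
have [G GE] := lfun_mulmx (linfun (@fst 'cV[K]_n 'cV[K]_n) \o s)%VF.
have {}GE e : G *m e = (s e).1 by rewrite -GE lfunE /= lfunE.
(* The right factor [P] puts the argument into the range, where isotropy of the section gives the
   symmetry. The left factor changes first components only by kernel elements and gives V' A0 =
   0. *)
exists (P *m G *m P), V, V'; split=> //.
- apply: inner_mulmx_inj => x y.
  rewrite -!mulmxA inner_mulmxl PE GE -scalemxAl innerZl inner_mulmxl ctrmxK.
  rewrite -!mulmxA [inner x _]inner_conj inner_mulmxl PE -inner_conj GE.
  have := isoA (sA (P *m y)) (sA (P *m x)).
  by rewrite !s2 // => ->; rewrite mulrA eps2 mul1r.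
- by rewrite !mulmxA V'P !mul0mx.
- move=> f e; split=> [fA|[Ve [c ->]]].
    have eran : e \in relran by apply/mem_relran; exists f.
    split; first exact/ranP.
    rewrite -!mulmxA (Pid e) // GE.
    have : f - (s e).1 \in relker A.
      rewrite mem_relker -(subrr e) -{3}(s2 e eran).
      exact: memvB fA (sA e).
    (* The second summand restores the kernel component V V' (s e).1 that the left factor [P]
       removes. *)
    move=> /memV[c fc]; exists (c + V' *m (s e).1).
    rewrite /P mulmxBl mul1mx mulmxDr -fc mulmxA [f - _ + _]addrC addrA subrK.
    by rewrite addrC subrK.
  have eran : e \in relran by apply/ranP.
  (* The candidate pair and [s e] share the second component e, so it suffices that their first
     components differ by a kernel element. *)
  have : (P *m G *m P *m e + V *m c - (s e).1) \in relker A.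
    apply/memV; exists (c - V' *m (s e).1).
    rewrite -!mulmxA (Pid e) // GE /P mulmxBl mul1mx mulmxBr.
    by rewrite mulmxA addrAC [_ - _ - (s e).1]addrAC subrr sub0r addrC.
  rewrite mem_relker => /memvD/(_ (sA e)).
  rewrite (_ : _ + s e = (P *m G *m P *m e + V *m c, e)) //.
  by apply: injective_projections; rewrite /= ?subrK // add0r s2.
Qed.

End Relations.

End Hermitian.

(** * The descriptor system *)

Section Representation.
Variables (R : realType) (k : scalars).
Local Notation K := (scalarField R k).

(** Subtracting V'^* V^* z from z enforces the constraint but leaves A0 z unchanged, since A0 V'^* =
    (V' A0)^* = 0. A sign known only on pairs of the relation thereby extends to the whole quadratic
    form. *)
Lemma representation_quadratic n d (A0 : 'M[K]_n) (V : 'M[K]_(n, d))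
    (V' : 'M[K]_(d, n)) (z : 'cV[K]_n) :
  A0 = ctrmx A0 -> V' *m V = 1%:M -> V' *m A0 = 0 ->
  exists e, [/\ ctrmx V *m e = 0, A0 *m e = A0 *m z &
    inner (A0 *m z) z = inner (A0 *m e) e].
Proof.
move=> A0H V'V V'A0; have A0V' : A0 *m ctrmx V' = 0.
  by rewrite A0H -ctrmx_mul V'A0 ctrmx0.
exists (z - ctrmx V' *m (ctrmx V *m z)).
have A0e : A0 *m (z - ctrmx V' *m (ctrmx V *m z)) = A0 *m z.
  by rewrite mulmxBr (mulmxA A0) A0V' mul0mx subr0.
split=> //.
  by rewrite mulmxBr (mulmxA (ctrmx V)) -ctrmx_mul V'V ctrmx1 mul1mx subrr.
rewrite A0e innerDr innerNr -[X in inner _ (X *m _)]ctrmxK -inner_mulmxl.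
by rewrite mulmxA ctrmxK V'A0 mul0mx inner0l subr0.
Qed.

Lemma psdmx_block0 p q (A : 'M[K]_p) : psdmx A ->
  psdmx (block_mx A 0 0 (0 : 'M[K]_q)).
Proof.
move=> [AH A0]; split; first by rewrite ctrmx_block !ctrmx0 -AH.
move=> x; rewrite -[x]vsubmxK mul_block_col !mul0mx !addr0 inner_col inner0l.
by rewrite addr0.
Qed.

Lemma psdmx_0block p q (A : 'M[K]_q) : psdmx A ->
  psdmx (block_mx (0 : 'M[K]_p) 0 0 A).
Proof.
move=> [AH A0]; split; first by rewrite ctrmx_block !ctrmx0 -AH.
move=> x; rewrite -[x]vsubmxK mul_block_col !mul0mx !add0r inner_col inner0l.
by rewrite add0r.
Qed.

(** The pointwise algebra behind both directions, with [a] in the role of (L0 e_L)'. The first n + r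
    rows and the output row express membership in D; the remaining rows are the three range
    constraints. The hypothesis on [dl] makes B^* reproduce the output row, and [nu] is the negative
    of the multiplier of R. *)
Lemma descriptor_equation n r m dD dR dL
    (ul : 'M[K]_(n + r)) (ur : 'M[K]_(n + r, m)) (dl : 'M[K]_(m, n + r))
    (dr : 'M[K]_m) (Vu : 'M[K]_(n + r, dD)) (Vd : 'M[K]_(m, dD))
    (R0 : 'M[K]_r) (VR : 'M[K]_(r, dR)) (VL : 'M[K]_(n, dL))
    (a eL : 'cV[K]_n) (eR : 'cV[K]_r) (u y : 'cV[K]_m)
    (l : 'cV[K]_dD) (nu : 'cV[K]_dR) (mu : 'cV[K]_dL) :
  dl = - ctrmx ur ->
  let C := row_mx (row_mx Vu (col_mx 0 VR)) (col_mx VL 0) in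
  let J := block_mx (- ul) (- C) (ctrmx C) 0 in
  let Rm := block_mx (block_mx 0 0 0 (- R0)) 0 0 0 in
  let B := col_mx (- ur) (col_mx (col_mx (ctrmx Vd) 0) 0) in
  let z := col_mx (col_mx eL eR) (col_mx (col_mx l nu) mu) in
  col_mx (col_mx (col_mx a 0) 0) y =
    block_mx (J - Rm) (B - 0) (ctrmx (B + 0)) (0 + dr)
      *m col_mx (1%:M *m z) u <->
  [/\ col_mx (col_mx (- (a + VL *m mu)) (R0 *m eR - VR *m nu)) y =
        block_mx ul ur dl dr *m col_mx (col_mx eL eR) u + col_mx Vu Vd *m l,
      ctrmx (col_mx Vu Vd) *m col_mx (col_mx eL eR) u = 0,
      ctrmx VR *m eR = 0 & ctrmx VL *m eL = 0].
Proof.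
move=> dlE C J Rm B z.
rewrite subr0 addr0 add0r mul1mx /J /Rm /B /z.
rewrite opp_block_mx add_block_mx !mul_block_col ctrmx_col !ctrmx_row.
rewrite !ctrmx_col !ctrmx0 !ctrmxN -dlE ctrmxK.
rewrite ?(mul_row_col, mul_col_mx, mul_mx_row, mul_block_col).
rewrite !subr0 !mulmxBl !mulNmx /C.
rewrite ?(mul_row_col, mul_col_mx, mul_mx_row, mul_block_col, mulNmx, mul0mx).
rewrite !(addr0, add0r, opp_col_mx, opprK, oppr0, add_col_mx).
rewrite -(addrA (ul *m _)) [dl *m _ + _ + _]addrAC.
move: (ul *m _) (ur *m u) (Vu *m l) (VL *m mu) (VR *m nu) (R0 *m eR).
move=> p1 p2 p3 vmu vnu w.
rewrite -[p1]vsubmxK -[p2]vsubmxK -[p3]vsubmxK.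
rewrite !(opp_col_mx, add_col_mx, addr0, add0r).
(* Two equations whose defects are opposite are equivalent; this leaves only ring identities between
   entries. *)
have eq_iff q (a1 b1 a2 b2 : 'cV[K]_q) : a1 - b1 = b2 - a2 -> a1 = b1 <-> a2 = b2.
  move=> ab; split=> ab'; move: ab.
    by rewrite ab' subrr => /esym/subr0_eq ->.
  by rewrite ab' subrr => /subr0_eq ->.
have topE : a = - usubmx p1 - (usubmx p3 + vmu) - usubmx p2 <->
    - (a + vmu) = usubmx p1 + (usubmx p2 + usubmx p3).
  by apply: eq_iff; move: (usubmx p1) (usubmx p2) (usubmx p3) => q1 q2 q3;
    apply/colP => i; rewrite !mxE; ring.
have botE : 0 = - dsubmx p1 + w - (dsubmx p3 + vnu) - dsubmx p2 <->
    w - vnu = dsubmx p1 + (dsubmx p2 + dsubmx p3).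
  by apply: eq_iff; move: (dsubmx p1) (dsubmx p2) (dsubmx p3) => q1 q2 q3;
    apply/colP => i; rewrite !mxE; ring.
rewrite -[X in col_mx (col_mx a 0) X](col_mx0 _ (dD + dR)) -(col_mx0 _ dD dR).
split=> [|[]].
  by move=> /eq_col_mx[/eq_col_mx[/eq_col_mx[/topE -> /botE ->]
    /eq_col_mx[/eq_col_mx[<- <-] <-]] ->].
by move=> /eq_col_mx[/eq_col_mx[/topE -> /botE <-] ->] -> -> ->.
Qed.

End Representation.

Section HalfLineBlocks.
Variables (R : realType) (k : scalars).
Local Notation K := (scalarField R k).

(** Stacking, like the block extractions below, is expressed by products with constant matrices,
    which preserve continuity. *)
Lemma continuous_halfline_col p q (x : R -> 'cV[K]_p) (y : R -> 'cV[K]_q) :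
  continuous_halfline x -> continuous_halfline y ->
  continuous_halfline (fun t => col_mx (x t) (y t)).
Proof.
move=> xc yc; apply: (@eq_continuous_halfline _ _ _
  (fun t => col_mx 1%:M 0 *m x t + col_mx 0 1%:M *m y t)).
  by move=> t _; rewrite !mul_col_mx !mul1mx !mul0mx add_col_mx addr0 add0r.
by apply: continuous_halflineD; apply: continuous_halfline_mulmx.
Qed.

Lemma continuous_halfline_usub p q (x : R -> 'cV[K]_(p + q)) :
  continuous_halfline x -> continuous_halfline (fun t => usubmx (x t)).
Proof.
move=> xc; apply: (@eq_continuous_halfline _ _ _
  (fun t => row_mx 1%:M 0 *m x t)); last exact: continuous_halfline_mulmx.
by move=> t _; rewrite -{1}[x t]vsubmxK mul_row_col mul1mx mul0mx addr0.
Qed.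

Lemma continuous_halfline_dsub p q (x : R -> 'cV[K]_(p + q)) :
  continuous_halfline x -> continuous_halfline (fun t => dsubmx (x t)).
Proof.
move=> xc; apply: (@eq_continuous_halfline _ _ _
  (fun t => row_mx 0 1%:M *m x t)); last exact: continuous_halfline_mulmx.
by move=> t _; rewrite -{1}[x t]vsubmxK mul_row_col mul1mx mul0mx add0r.
Qed.

Lemma continuous_halflineN n (x : R -> 'cV[K]_n) :
  continuous_halfline x -> continuous_halfline (fun t => - x t).
Proof.
move=> xc; apply: (@eq_continuous_halfline _ _ _ (fun t => - 1%:M *m x t)).
  by move=> t _; rewrite mulNmx mul1mx.
exact: continuous_halfline_mulmx.
Qed.

End HalfLineBlocks.

(** * Matrix forms of Lagrange, Dirac and maximal resistive structures *)

Section Structures.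
Variables (R : realType) (k : scalars).
Local Notation K := (scalarField R k).

Lemma lagrangeP n (L : {vspace 'cV[K]_n * 'cV[K]_n}) : Defs.lagrange L ->
  forall w, w \in L <-> forall v, v \in L -> inner w.2 v.1 = 1 * inner w.1 v.2.
Proof.
rewrite /Defs.lagrange => /seteqP[LL' L'L] w; split=> [wL v vL|wL].
  by rewrite mul1r; exact: (LL' w).
by apply: L'L => v vL; rewrite -[RHS]mul1r; exact: wL.
Qed.

Lemma diracP n (D : {vspace 'cV[K]_n * 'cV[K]_n}) : Defs.dirac D ->
  forall w, w \in D <-> forall v, v \in D -> inner w.2 v.1 = -1 * inner w.1 v.2.
Proof.
rewrite /Defs.dirac => /seteqP[DD' D'D] w; split=> [/DD'[w' w'D <-] v vD|wD].
  by rewrite /= scaleN1r innerNl mulN1r w'D.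
apply: D'D; exists (w.1, - w.2) => /=.
  by move=> v vD; rewrite /= innerNl wD // mulN1r opprK.
by rewrite scaleN1r opprK -surjective_pairing.
Qed.

Lemma lagrange_representation n (L : {vspace 'cV[K]_n * 'cV[K]_n}) :
  Defs.lagrange L ->
  exists (L0 : 'M[K]_n) (V : 'M[K]_(n, \dim (relker L)))
      (V' : 'M[K]_(\dim (relker L), n)),
    [/\ L0 = ctrmx L0, V' *m V = 1%:M, V' *m L0 = 0 &
      forall f e, (f, e) \in L <->
        ctrmx V *m e = 0 /\ exists c, f = L0 *m e + V *m c].
Proof.
move=> /lagrangeP memL; have one2 : 1 * 1 = 1 :> K by rewrite mulr1.
have [|L0 [V [V' [L0H ? ? ?]]]] :=
  relation_representation one2 _ (dim_maximal_isotropic one2 memL).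
  by move=> v w vL /memL; apply.
by exists L0, V, V'; split=> //; rewrite {1}L0H scale1r.
Qed.

Lemma dirac_representation n (D : {vspace 'cV[K]_n * 'cV[K]_n}) : Defs.dirac D ->
  exists (J0 : 'M[K]_n) (V : 'M[K]_(n, \dim (relker D)))
      (V' : 'M[K]_(\dim (relker D), n)),
    [/\ J0 = - ctrmx J0, V' *m V = 1%:M, V' *m J0 = 0 &
      forall f e, (f, e) \in D <->
        ctrmx V *m e = 0 /\ exists c, f = J0 *m e + V *m c].
Proof.
move=> /diracP memD; have one2 : -1 * -1 = 1 :> K by rewrite mulrNN mulr1.
have [|J0 [V [V' [J0H ? ? ?]]]] :=
  relation_representation one2 _ (dim_maximal_isotropic one2 memD).
  by move=> v w vD /memD; apply.
by exists J0, V, V'; split=> //; rewrite {1}J0H scaleN1r.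
Qed.

(** Isotropy and dimension are both part of the definition here, whereas for L and D the dimension
    comes from [dim_maximal_isotropic]. *)
Lemma max_resistive_representation n (Rs : {vspace 'cV[K]_n * 'cV[K]_n}) :
  max_resistive Rs ->
  exists (R0 : 'M[K]_n) (V : 'M[K]_(n, \dim (relker Rs)))
      (V' : 'M[K]_(\dim (relker Rs), n)),
    [/\ R0 = ctrmx R0, V' *m V = 1%:M, V' *m R0 = 0 &
      forall f e, (f, e) \in Rs <->
        ctrmx V *m e = 0 /\ exists c, f = R0 *m e + V *m c].
Proof.
move=> [[RR' _] dimR]; have one2 : 1 * 1 = 1 :> K by rewrite mulr1.
have [|R0 [V [V' [R0H ? ? ?]]]] := relation_representation one2 _ dimR.
  by move=> v w vR /RR' wR; rewrite mul1r; exact: wR.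
by exists R0, V, V'; split=> //; rewrite {1}R0H scale1r.
Qed.

End Structures.

(** * Assembly of the system and transfer of solutions in both directions *)

Theorem theorem15 (R : realType) (k : scalars) (n m r : nat)
    (D : {vspace 'cV[scalarField R k]_(n + r + m) * 'cV[scalarField R k]_(n + r + m)})
    (L : {vspace 'cV[scalarField R k]_n * 'cV[scalarField R k]_n})
    (Rs : {vspace 'cV[scalarField R k]_r * 'cV[scalarField R k]_r})
    (hDLR : geometric_pH D L Rs) :
  let p := (\dim (relker D) + \dim (relker Rs) + \dim (relker L))%N in
  exists (E J Rm : 'M[scalarField R k]_(n + r + p))
         (B : 'M[scalarField R k]_(n + r + p, m))
         (N : 'M[scalarField R k]_m),
    [/\ pH_descriptor E J Rm 1%:M B 0 0 N,
        forall (u : R -> 'cV[scalarField R k]_m)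
               (x : R -> 'cV[scalarField R k]_n)
               (y : R -> 'cV[scalarField R k]_m),
          geometric_pH_solution D L Rs u x y ->
          exists z : R -> 'cV[scalarField R k]_(n + r + p),
            pH_descriptor_solution E J Rm 1%:M B 0 0 N u z y,
        forall (u : R -> 'cV[scalarField R k]_m)
               (z : R -> 'cV[scalarField R k]_(n + r + p))
               (y : R -> 'cV[scalarField R k]_m),
          pH_descriptor_solution E J Rm 1%:M B 0 0 N u z y ->
          forall x0 : 'cV[scalarField R k]_n,
            (x0, usubmx (usubmx (z 0))) \in L ->
            exists x : R -> 'cV[scalarField R k]_n,
              geometric_pH_solution D L Rs u x y /\ x 0 = x0 &
        resistive (relscale (-1) [set` L]) -> E = ctrmx E /\ psdmx E].
Proof.
case: hDLR => hD hL hR p.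
have [J0 [V [V' [J0H V'V V'J0 memD]]]] := dirac_representation hD.
have [L0 [VL [VL' [L0H VL'VL VL'L0 memL]]]] := lagrange_representation hL.
have [R0 [VR [VR' [R0H VR'VR VR'R0 memR]]]] := max_resistive_representation hR.
(* The blocks follow the splitting of the second component of D into (e_L, e_R) and u. *)
pose ul := ulsubmx J0; pose ur := ursubmx J0.
pose dl := dlsubmx J0; pose dr := drsubmx J0.
pose Vu := usubmx V; pose Vd := dsubmx V.
have J0E : J0 = block_mx ul ur dl dr by rewrite submxK.
have VE : V = col_mx Vu Vd by rewrite vsubmxK.
have [ulE dlE drE] : [/\ ul = - ctrmx ul, dl = - ctrmx ur & dr = - ctrmx dr].
  move: J0H; rewrite J0E ctrmx_block opp_block_mx.
  by move=> /eq_block_mx[].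
rewrite J0E VE in memD V'V V'J0 => {J0E VE J0H}.
have L0_psd : resistive (relscale (-1) [set` L]) -> psdmx L0.
  move=> [_ rL]; split=> // z.
  have [e [Ve _ ->]] := representation_quadratic z L0H VL'VL VL'L0.
  have /rL : relscale (-1) [set` L] (L0 *m e, -1 *: e).
    exists (L0 *m e, e) => //=; apply/memL; split=> //.
    by exists 0; rewrite mulmx0 addr0.
  by rewrite /= scaleN1r innerNr oppr_le0.
have R0_psd : psdmx (- R0).
  split=> [|z]; first by rewrite ctrmxN -R0H.
  have [e [Ve _ eE]] := representation_quadratic z R0H VR'VR VR'R0.
  rewrite mulNmx innerNl eE oppr_ge0; case: hR => -[_ rR] _.
  apply: (rR (R0 *m e, e)); apply/memR; split=> //.
  by exists 0; rewrite mulmx0 addr0.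
pose E : 'M[scalarField R k]_(n + r + p) := block_mx (block_mx L0 0 0 0) 0 0 0.
(* The columns of [C] are the kernel directions of D, R and L. Using -C and C^* as off-diagonal
   blocks of [J] makes multipliers and constraints enter skew-adjointly. *)
pose C : 'M[scalarField R k]_(n + r, p) :=
  row_mx (row_mx Vu (col_mx 0 VR)) (col_mx VL 0).
pose J : 'M[scalarField R k]_(n + r + p) := block_mx (- ul) (- C) (ctrmx C) 0.
pose Rm : 'M[scalarField R k]_(n + r + p) :=
  block_mx (block_mx 0 0 0 (- R0)) 0 0 0.
pose B : 'M[scalarField R k]_(n + r + p, m) :=
  col_mx (- ur) (col_mx (col_mx (ctrmx Vd) 0) 0).
exists E, J, Rm, B, dr.
have Rm_psd : psdmx Rm by do 2?[apply: psdmx_block0]; exact: psdmx_0block.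
have eqn a eL eR u y l nu mu :=
  @descriptor_equation R k n r m _ _ _ ul ur dl dr Vu Vd R0 VR VL
    a eL eR u y l nu mu dlE.
have E_mul (eL : 'cV_n) (eR : 'cV_r) (c : 'cV_p) :
    E *m col_mx (col_mx eL eR) c = col_mx (col_mx (L0 *m eL) 0) 0.
  by rewrite !mul_block_col !mul0mx !addr0.
split.
- split; last first.
    (* With Q = I and P = S = 0 the dissipation matrix is diag(Rm, 0). *)
    rewrite ctrmx1 ctrmx0 -scalar_mx_block mul1mx mulmx1.
    exact: psdmx_block0.
  split=> //; last by rewrite ctrmx0.
  + by rewrite ctrmx1 mul1mx mulmx1 /E !ctrmx_block !ctrmx0 -L0H.
  + rewrite /J ctrmx_block opp_block_mx !ctrmxN ctrmxK ctrmx0 oppr0 opprK.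
    by rewrite {1}ulE !opprK.
  + by case: Rm_psd.
- move=> u x y [uc yc [dx [[xd dxc] [fR [eR [eL [fRc eRc eLc sol]]]]]]].
  pose g t := col_mx (col_mx (- dx t) (fR t)) (y t).
  (* The left inverses read off the multipliers: V' annihilates J0 and VR' annihilates R0, so only
     the kernel coefficients survive. They are continuous because [g], [fR] and [dx] are. *)
  exists (fun t => col_mx (col_mx (eL t) (eR t))
    (col_mx (col_mx (V' *m g t) (- VR' *m fR t)) (VL' *m dx t))).
  have gc : continuous_halfline g.
    by do 2?[apply: continuous_halfline_col]; try exact: continuous_halflineN.
  split=> //.
    by do 3?[apply: continuous_halfline_col => //];
      apply: continuous_halfline_mulmx.
  (* Along a solution E z = Q x, since 1 - VL VL' removes VL c_L from x. Hence E z is C^1 although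
     e_L is only known to be continuous. *)
  pose Q : 'M[scalarField R k]_(n + r + p, n) :=
    col_mx (col_mx (1%:M - VL *m VL') 0) 0.
  have QE b : Q *m b = col_mx (col_mx (b - VL *m (VL' *m b)) 0) 0.
    by rewrite !mul_col_mx !mul0mx mulmxBl mul1mx -mulmxA.
  exists (fun t => Q *m dx t); split.
    split; last exact: continuous_halfline_mulmx.
    apply: eq_derivative_halfline (derivative_halfline_mulmx (A := Q) xd) => t t0.
    have [_ /memL[_ [c ->]] _] := sol t t0.
    rewrite E_mul QE; congr (col_mx (col_mx _ _) _).
    by rewrite mulmxDr !(mulmxA VL') VL'L0 VL'VL mul0mx mul1mx add0r addrK.
  move=> t t0.
  have [/memD[Dt1 [c Dt2]] /memL[Lt _] /memR[Rt [nu fRt]]] := sol t t0.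
  rewrite QE; apply/eqn; split=> //.
  have -> : V' *m g t = c.
    by rewrite /g Dt2 mulmxDr !mulmxA V'J0 V'V mul0mx mul1mx add0r.
  rewrite -Dt2 subrK mulNmx mulmxN opprK.
  congr (col_mx (col_mx _ _) _).
  rewrite {2}fRt; congr (_ + VR *m _).
  by rewrite fRt mulmxDr !mulmxA VR'R0 VR'VR mul0mx mul1mx add0r.
- move=> u z y [uc zc yc [dEz [[Ezd dEzc] sol]]] x0 x0L.
  pose w t := usubmx (z t); pose eL t := usubmx (w t); pose eR t := dsubmx (w t).
  pose c t : 'cV_p := dsubmx (z t).
  pose l t := usubmx (usubmx (c t)); pose nu t := dsubmx (usubmx (c t)).
  pose mu t := dsubmx (c t).
  have zE t : z t =
      col_mx (col_mx (eL t) (eR t)) (col_mx (col_mx (l t) (nu t)) (mu t)).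
    by rewrite !vsubmxK.
  have wc : continuous_halfline w by exact: continuous_halfline_usub.
  have cc : continuous_halfline c by exact: continuous_halfline_dsub.
  have muc : continuous_halfline mu by exact: continuous_halfline_dsub.
  have nuc : continuous_halfline nu.
    by apply: continuous_halfline_dsub; exact: continuous_halfline_usub.
  have eRc : continuous_halfline eR by exact: continuous_halfline_dsub.
  have eLc : continuous_halfline eL by exact: continuous_halfline_usub.
  pose P1 : 'M[scalarField R k]_(n, n + r + p) := row_mx (row_mx 1%:M 0) 0.
  pose a t := P1 *m dEz t.
  have P1E (t : R) : P1 *m (E *m z t) = L0 *m eL t.
    by rewrite zE E_mul !mul_row_col !mul0mx mul1mx !addr0.
  (* The lower blocks of E z vanish identically, so those of its derivative vanish by uniqueness of
     derivatives on the half-line. *)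
  have dEzE t : 0 <= t -> dEz t = col_mx (col_mx (a t) 0) 0.
    pose Q : 'M[scalarField R k]_(n + r + p, n) := col_mx (col_mx 1%:M 0) 0.
    move=> t0; have QE (b : 'cV_n) : col_mx (col_mx b 0) 0 = Q *m b.
      by rewrite !mul_col_mx !mul0mx mul1mx.
    rewrite QE; move: t t0; apply: (derivative_halfline_unique Ezd).
    apply: eq_derivative_halfline
      (derivative_halfline_mulmx (A := Q)
         (derivative_halfline_mulmx (A := P1) Ezd)).
    by move=> t _; rewrite P1E -QE zE E_mul.
  have [/memL[_ [c0 x0E]]] := x0L.
  (* [M] plays the role of c_L. Since [x0] and L0 e_L(0) differ by VL c0, the initial value c0
     yields x(0) = x0. *)
  have [M [[Md Mc] M0]] := antiderivative_halfline c0 muc.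
  exists (fun t => L0 *m eL t + VL *m M t); split; last by rewrite M0 x0E.
  split=> //; exists (fun t => a t + VL *m mu t); split; first split.
  + apply: derivative_halflineD; last exact: derivative_halfline_mulmx.
    apply: eq_derivative_halfline (derivative_halfline_mulmx (A := P1) Ezd).
    by move=> t _; exact: P1E.
  + by apply: continuous_halflineD; exact: continuous_halfline_mulmx.
  exists (fun t => R0 *m eR t - VR *m nu t), eR, eL; split=> //.
    apply: continuous_halflineD; first exact: continuous_halfline_mulmx.
    by apply: continuous_halflineN; exact: continuous_halfline_mulmx.
  move=> t t0; have := sol t t0.
  rewrite dEzE // zE => /eqn[Dt1 Dt2 Rt Lt]; split.
  + by apply/memD; split=> //; exists (l t).
  + by apply/memL; split=> //; exists (M t).
  + by apply/memR; split=> //; exists (- nu t); rewrite mulmxN.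
- move=> /L0_psd L0p; have : psdmx E by do 2?[apply: psdmx_block0].
  by move=> Ep; split=> //; case: Ep.
Qed.
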